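(* Consider a Bounded Knapsack Problem instance with items $I=\{1,\dots,n\}$ (profits $p_i$, weights $w_i$, availabilities $d_i$, all positive integers), capacity $W$, items indexed in non-increasing order of efficiency $p_i/w_i$, break item $b$, left items $I_{\text{left}}=\{i:i<b\}$, incumbent value $z\in\mathbb{Z}$, and unfixed availability vector $u$ (as in the context). Let $I^1_{\text{left}}=\{i\in I_{\text{left}}: u_i=1\}$. Assume that every improved solution $x$ contains at least $|I^1_{\text{left}}|-1$ unfixed copies of items in $I^1_{\text{left}}$, i.e. $x_i=d_i$ holds for at least $|I^1_{\text{left}}|-1$ items $i\in I^1_{\text{left}}$. Let $h\in I^1_{\text{left}}$ and let $V_h$ be the optimal value of the FBKP relaxation of the modified instance obtained by reducing the availability of $h$ by one (defined precisely in the context). If $V_h<z+1$ (or the relaxation is infeasible), then one can set $u_h=0$ in the original instance without loss of optimality; that is, every improved solution $x$ satisfies $x_h=d_h$.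
   Context: A solution is an integer vector $x$ with $0\le x_i\le d_i$ and $\sum_iw_ix_i\le W$; its value is $\sum_ip_ix_i$. The break item $b$ satisfies $\sum_{i<b}d_iw_i\le W<\sum_{i\le b}d_iw_i$; items $i<b$ are left items, items $i\ge b$ right items. An improved solution is a solution with value at least $z+1$. The vector $u\in\mathbb{Z}^n$, $0\le u_i\le d_i$, is assumed to satisfy: every improved solution has $d_i-u_i\le x_i\le d_i$ for left $i$ and $0\le x_i\le u_i$ for right $i$. The modified instance for $h$ is described by fixed amounts $f_i$ and residual availabilities $r_i$: for left $i\notin I^1_{\text{left}}$, $f_i=d_i-u_i$, $r_i=u_i$; for $i\in I^1_{\text{left}}\setminus\{h\}$, $f_i=d_i$, $r_i=0$; $f_h=d_h-1$, $r_h=0$; for right $i$, $f_i=0$, $r_i=u_i$. Let $\widehat w_h=\sum_i f_iw_i$, let $I^h_{\text{res}}=\{i: r_i>0\}$ (assumed nonempty), let $g_h$ be the gcd of $\{w_i:i\in I^h_{\text{res}}\}$, and let $\overline W_h=\widehat w_h+\lfloor (W-\widehat w_h)/g_h\rfloor g_h$ (the divisibility-tightened capacity). The FBKP relaxation of the modified instance is the linear program: maximize $\sum_ip_ix_i$ over real $x$ with $f_i\le x_i\le f_i+r_i$ for all $i$ and $\sum_iw_ix_i\le \overline W_h$; $V_h$ is its optimal value. *)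

(* Defs.v *)
From HB Require Import structures.
From mathcomp Require Import all_boot all_order all_algebra.
From mathcomp Require Import reals.

Set Implicit Arguments.
Unset Strict Implicit.
Unset Printing Implicit Defensive.

Import Order.TTheory GRing.Theory Num.Theory.
Local Open Scope ring_scope.

(* Numerical data are integers rather than naturals, so that no subtraction is
   truncated; positivity is required by [positive_data]. *)
Record bkp (n : nat) := BKP {
  profit : 'I_n -> int;
  weight : 'I_n -> int;
  avail : 'I_n -> int;
  capacity : int
}.

Definition positive_data n (K : bkp n) : Prop :=
  forall i, [/\ 0 < profit K i, 0 < weight K i & 0 < avail K i].

Definition efficiency n (K : bkp n) (i : 'I_n) : rat :=
  (profit K i)%:Q / (weight K i)%:Q.

Definition efficiency_sorted n (K : bkp n) : Prop :=
  forall i j : 'I_n, (i <= j)%N -> efficiency K j <= efficiency K i.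

Definition break_item n (K : bkp n) (b : 'I_n) : Prop :=
  \sum_(i < n | (i < b)%N) avail K i * weight K i <= capacity K
    < \sum_(i < n | (i <= b)%N) avail K i * weight K i.

Definition solution n (K : bkp n) (x : 'I_n -> int) : Prop :=
  (forall i, 0 <= x i <= avail K i) /\
  \sum_(i < n) weight K i * x i <= capacity K.

Definition value n (K : bkp n) (x : 'I_n -> int) : int :=
  \sum_(i < n) profit K i * x i.

Definition improved n (K : bkp n) (z : int) (x : 'I_n -> int) : Prop :=
  solution K x /\ z + 1 <= value K x.

Definition left_items n (b : 'I_n) : {set 'I_n} := [set i : 'I_n | (i < b)%N].

Definition left1 n (b : 'I_n) (u : 'I_n -> int) : {set 'I_n} :=
  [set i in left_items b | u i == 1].

Definition unfixed_availability n (K : bkp n) (b : 'I_n) (z : int)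
    (u : 'I_n -> int) : Prop :=
  (forall i, 0 <= u i <= avail K i) /\
  (forall x, improved K z x ->
     (forall i, i \in left_items b -> avail K i - u i <= x i <= avail K i) /\
     (forall i, i \notin left_items b -> 0 <= x i <= u i)).

Section ModifiedInstance.

Variables (n : nat) (K : bkp n) (b : 'I_n) (u : 'I_n -> int) (h : 'I_n).

Definition fixed_amount (i : 'I_n) : int :=
  if i == h then avail K i - 1
  else if i \in left1 b u then avail K i
  else if i \in left_items b then avail K i - u i
  else 0.

Definition residual (i : 'I_n) : int :=
  if (i == h) || (i \in left1 b u) then 0 else u i.

Definition fixed_weight : int := \sum_(i < n) fixed_amount i * weight K i.

Definition residual_items : {set 'I_n} := [set i | 0 < residual i].

Definition residual_gcd : int :=
  \big[gcdz/0]_(i in residual_items) weight K i.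

(* [divz] rounds towards minus infinity when the divisor is positive, so it is
   the floor of the quotient even when [fixed_weight] exceeds the capacity. *)
Definition tight_capacity : int :=
  fixed_weight
  + ((capacity K - fixed_weight) %/ residual_gcd)%Z * residual_gcd.

Variable R : realType.

Definition fbkp_feasible (x : 'I_n -> R) : Prop :=
  (forall i, (fixed_amount i)%:~R <= x i
               <= (fixed_amount i + residual i)%:~R) /\
  \sum_(i < n) (weight K i)%:~R * x i <= tight_capacity%:~R.

Definition fbkp_value (x : 'I_n -> R) : R :=
  \sum_(i < n) (profit K i)%:~R * x i.

Definition fbkp_optimal_value (V : R) : Prop :=
  (exists2 x, fbkp_feasible x & fbkp_value x = V) /\
  (forall x, fbkp_feasible x -> fbkp_value x <= V).

End ModifiedInstance.

(* Main.v *)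
Require Import Defs.
From HB Require Import structures.
From mathcomp Require Import all_boot all_order all_algebra.
From mathcomp Require Import reals.
From mathcomp Require Import zify.

(* If an improved x had x_h <> d_h, then x_h = d_h - 1 and, by the counting
   assumption, h is the only item of I^1_left not at its full availability.  So
   x lies in the box of the modified instance, and its weight exceeds the fixed
   weight by a multiple of g_h, hence respects the tightened capacity: the
   relaxation is feasible with value at least z + 1. *)

Set Implicit Arguments.
Unset Strict Implicit.
Unset Printing Implicit Defensive.

Import Order.TTheory GRing.Theory Num.Theory.
Local Open Scope ring_scope.

(** This is why the tightening loses no integer point: for [m = q * d], the integer [q] is at most
    [k / d], hence at most its floor, whatever the sign of [k]. *)
Lemma le_divz_mul (d m k : int) :
  0 < d -> (d %| m)%Z -> m <= k -> m <= (k %/ d)%Z * d.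
Proof.
move=> d_gt0 /dvdzP[q ->] le_qd_k.
by rewrite ler_pM2r // lez_divRL.
Qed.

Lemma dvdz_biggcd (I : finType) (A : {set I}) (F : I -> int) i :
  i \in A -> (\big[gcdz/0]_(j in A) F j %| F i)%Z.
Proof.
(* Induction on the enumeration, generalised over the membership of [i] in it. *)
move=> iA; elim: (index_enum I) (mem_index_enum i) => // j s IHs.
rewrite inE big_cons => /predU1P[<-|/IHs dvd_s]; first by rewrite iA dvdz_gcdl.
by case: ifP => // _; apply: dvdz_trans dvd_s; exact: dvdz_gcdr.
Qed.

Lemma biggcdz_ge0 (I : finType) (A : {set I}) (F : I -> int) :
  0 <= \big[gcdz/0]_(j in A) F j.
Proof. by elim/big_rec: _. Qed.

(** The gcd of no weights is 0; a single residual item excludes this, since 0 divides no positive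
    weight. *)
Lemma residual_gcd_gt0 n (K : bkp n) (b : 'I_n) (u : 'I_n -> int) (h : 'I_n) :
  positive_data K -> residual_items b u h != set0 -> 0 < residual_gcd K b u h.
Proof.
move=> Kpos /set0Pn[i ires]; rewrite lt_def biggcdz_ge0 andbT.
apply/negP => /eqP g0; have [_ w_gt0 _] := Kpos i.
have := dvdz_biggcd (weight K) ires; rewrite -/(residual_gcd K b u h) g0 dvd0z.
by rewrite gt_eqF.
Qed.

Lemma all_but_one (I : finType) (A : {set I}) (P : pred I) h :
  (#|A| - 1 <= #|[set i in A | P i]|)%N -> h \in A -> ~~ P h ->
  forall i, i \in A -> i != h -> P i.
Proof.
move=> leA hA nPh i iA ih.
have sub : [set i in A | P i] \subset A :\ h.
  by apply/subsetP => j; rewrite !inE => /andP[-> Pj]; rewrite andbT;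
     apply: contraTneq Pj => ->.
(* Inclusion becomes equality because [A :\ h] has exactly [#|A| - 1] elements. *)
have /eqP eqA : [set i in A | P i] == A :\ h.
  by rewrite eqEcard sub; move: leA; rewrite (cardsD1 h A) hA add1n subn1.
by have : i \in A :\ h; [rewrite !inE ih | rewrite -eqA inE => /andP[]].
Qed.

Lemma le_tight_capacity n (K : bkp n) (b : 'I_n) (u : 'I_n -> int) (h : 'I_n)
    (x : 'I_n -> int) :
  positive_data K -> residual_items b u h != set0 ->
  (forall i, fixed_amount K b u h i <= x i
             <= fixed_amount K b u h i + residual b u h i) ->
  \sum_(i < n) weight K i * x i <= capacity K ->
  \sum_(i < n) weight K i * x i <= tight_capacity K b u h.
Proof.
move=> Kpos res_neq0 box cap; rewrite -lerBlDl.
apply: le_divz_mul; [exact: residual_gcd_gt0 | | by rewrite lerB].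
(* The excess over the fixed weight is divisible by the gcd term by term. *)
rewrite /fixed_weight -sumrB; apply: rpred_sum => i _.
rewrite [_ * weight K i]mulrC -mulrBr.
have [ires|] := boolP (i \in residual_items b u h).
  by apply: dvdz_mulr; exact: dvdz_biggcd.
(* Without residual availability the interval for [x i] shrinks to a point, so the term vanishes. *)
rewrite inE -leNgt => r_le0; have /andP[fx xf] := box i.
have -> : x i = fixed_amount K b u h i.
  by apply/eqP; rewrite eq_le fx andbT (le_trans xf) // gerDl.
by rewrite subrr mulr0 dvdz0.
Qed.

Lemma improved_modified_box n (K : bkp n) (b : 'I_n) (z : int)
    (u : 'I_n -> int) (h : 'I_n) (x : 'I_n -> int) :
  unfixed_availability K b z u -> improved K z x -> h \in left1 b u ->
  (#|left1 b u| - 1 <= #|[set i in left1 b u | x i == avail K i]|)%N ->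
  x h != avail K h ->
  forall i, fixed_amount K b u h i <= x i
            <= fixed_amount K b u h i + residual b u h i.
Proof.
move=> [_ uP] imp hl cardl nxh i; have [xl xr] := uP x imp.
rewrite /fixed_amount /residual; case: eqVneq => [-> | ih] /=.
  move: (hl); rewrite inE => /andP[hL /eqP uh].
  (* As [u h = 1], only [avail K h - 1] and [avail K h] are possible, and [nxh] excludes the
     latter. *)
  by have := xl h hL; rewrite uh; lia.
have [il|_] := boolP (i \in left1 b u).
  by rewrite (eqP (all_but_one cardl hl nxh il ih)) addr0 lexx.
have [iL|iR] := boolP (i \in left_items b).
  by rewrite subrK; exact: xl.
by rewrite add0r; exact: xr.
Qed.

Theorem theorem1 (R : realType) (n : nat) (K : bkp n) (b : 'I_n) (z : int)
    (u : 'I_n -> int) (h : 'I_n)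
    (Kpos : positive_data K)
    (Ksorted : efficiency_sorted K)
    (bbreak : break_item K b)
    (uP : unfixed_availability K b z u)
    (left1P : forall x, improved K z x ->
       (#|left1 b u| - 1 <= #|[set i in left1 b u | x i == avail K i]|)%N)
    (hleft1 : h \in left1 b u)
    (res_neq0 : residual_items b u h != set0)
    (VhP : (~ exists x : 'I_n -> R, fbkp_feasible K b u h x) \/
           (exists2 Vh : R, fbkp_optimal_value K b u h Vh & Vh < (z + 1)%:~R)) :
  forall x, improved K z x -> x h = avail K h.
Proof.
move=> x imp; apply/eqP/negPn/negP => nxh.
have box := improved_modified_box uP imp hleft1 (left1P x imp) nxh.
have [[_ cap] val] := imp.
have feas : fbkp_feasible K b u h (fun i => (x i)%:~R : R).
  split=> [i|]; first by rewrite !ler_int; exact: box.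
  under eq_bigr do rewrite -intrM.
  by rewrite -rmorph_sum ler_int; exact: le_tight_capacity.
(* The point [x] refutes infeasibility; otherwise its value is at most [V < z + 1], against
   improvement. *)
case: VhP => [[]|[V [_ Vmax] Vlt]]; first by exists (fun i => (x i)%:~R).
have := le_lt_trans (Vmax _ feas) Vlt.
rewrite /fbkp_value; under eq_bigr do rewrite -intrM.
by rewrite -rmorph_sum ltr_int ltNge => /negP; apply.
Qed.
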